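(* Let $d\ge 1$, let $0<\rho<1$, let $O$ be a $d\times d$ orthogonal real matrix, and let $D\subset\mathbb{R}^d$ be a finite set with $\#D\ge 2$. Let $K\subset\mathbb{R}^d$ be the homogeneous self-similar set generated by the iterated function system $\Phi=\{f_b(x)=\rho O x+b : b\in D\}$, and let $\Psi=\{g_b(x)=\rho O x+b : b\in D-D\}$, whose self-similar set is $K-K$. If $\Psi$ satisfies the strong separation condition, then there exists a constant $\beta<\dim_H K$ such that for any two non-empty sets $K_1,K_2\subset\mathbb{R}^d$ satisfying $K_1+K_2\subset K$ we have $$\dim_H K_1+\dim_H K_2\le 2\beta .$$ Consequently, the set $K$ does not have the Hausdorff $2$-sumset property (HSP-$2$), and hence does not have the Hausdorff sumset property (HSP).
   Context: For sets $A,B\subset\mathbb{R}^d$, $A+B=\{a+b: a\in A, b\in B\}$ and $A-B=\{a-b: a\in A, b\in B\}$; $\#$ denotes cardinality; $\dim_H$ denotes Hausdorff dimension. The self-similar set generated by a finite family (iterated function system) $\{f_j\}_{j=1}^m$ of contracting similarities of $\mathbb{R}^d$ is the unique non-empty compact set $K$ with $K=\bigcup_{j=1}^m f_j(K)$. Here $K=\{\sum_{k=1}^\infty(\rho O)^{k-1}b_k : b_k\in D\ \forall k\ge1\}$ and $K-K=\{\sum_{k=1}^\infty(\rho O)^{k-1}t_k : t_k\in D-D\ \forall k\ge1\}$, where $D-D$ is regarded as a set (each element counted once). An iterated function system $\{f_j\}_{j=1}^m$ with self-similar set $E$ satisfies the strong separation condition if the sets $f_1(E),\dots,f_m(E)$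 are pairwise disjoint. (For $\Psi$ this means that the sets $g_b(K-K)$, $b\in D-D$, are pairwise disjoint.) For an integer $\ell\ge 2$, a compact set $K\subset\mathbb{R}^d$ has the Hausdorff $\ell$-sumset property (HSP-$\ell$) if there exist compact sets $K_1,\dots,K_\ell\subset\mathbb{R}^d$ such that $K_1+\cdots+K_\ell\subset K$ and $\dim_H K_i=\dim_H K$ for all $1\le i\le\ell$. It has the Hausdorff sumset property (HSP) if it has HSP-$\ell$ for all integers $\ell\ge2$. *)

(* Defs.v *)
From HB Require Import structures.
From mathcomp Require Import all_boot all_order all_algebra finmap.
From mathcomp Require Import all_classical all_reals all_analysis.
Import Order.TTheory GRing.Theory Num.Theory.
Import numFieldNormedType.Exports.

Set Implicit Arguments.
Unset Strict Implicit.
Unset Printing Implicit Defensive.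

Local Open Scope classical_set_scope.
Local Open Scope ring_scope.

Definition set_add {V : zmodType} (A B : set V) : set V :=
  [set a + b | a in A & b in B].

Definition set_sub {V : zmodType} (A B : set V) : set V :=
  [set a - b | a in A & b in B].

Definition set_sum {V : zmodType} (l : nat) (A : 'I_l -> set V) : set V :=
  [set \sum_(i < l) a i | a in [set a : 'I_l -> V | forall i, A i (a i)]].

(* R^d is 'cV[R]_d. The library norm on matrices is the sup norm, so the
   Euclidean norm is written out; the two induce the same topology, hence
   [compact] below is the usual notion. *)
Definition enorm {R : realType} {d : nat} (x : 'cV[R]_d) : R :=
  Num.sqrt (\sum_(i < d) x i ord0 ^+ 2).

(* Equal to -oo on the empty set. *)
Definition diam {R : realType} {d : nat} (U : set 'cV[R]_d) : \bar R :=
  ereal_sup [set (enorm (x - y))%:E | x in U & y in U].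

(* diam(U)^s, with the conventions 0^0 = 1 (built into [poweR]) for nonempty
   sets and diam(set0)^s = 0 for every s, including s = 0. *)
Definition diam_pow {R : realType} {d : nat} (s : R) (U : set 'cV[R]_d) :
    \bar R :=
  if U == set0 then 0%E else poweR (diam U) s.

Definition hausdorff_premeasure {R : realType} {d : nat} (s delta : R)
    (A : set 'cV[R]_d) : \bar R :=
  ereal_inf [set (\sum_(0 <= i <oo) diam_pow s (U i))%E |
    U in [set U : nat -> set 'cV[R]_d |
           A `<=` \bigcup_i U i /\ forall i, (diam (U i) <= delta%:E)%E]].

Definition hausdorff_measure {R : realType} {d : nat} (s : R)
    (A : set 'cV[R]_d) : \bar R :=
  ereal_sup [set hausdorff_premeasure s delta A |
    delta in [set delta : R | 0 < delta]].

(* With this definition the empty set has dimension 0. *)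
Definition dimH {R : realType} {d : nat} (A : set 'cV[R]_d) : \bar R :=
  ereal_inf [set s%:E |
    s in [set s : R | 0 <= s /\ hausdorff_measure s A = 0%E]].

(* E is the self-similar set generated by the family (f_j)_{j in J}; for a
   finite nonempty family of contracting similarities there is exactly one
   such E. *)
Definition self_similar_set {R : realType} {d : nat} {I : Type} (J : set I)
    (f : I -> 'cV[R]_d -> 'cV[R]_d) (E : set 'cV[R]_d) : Prop :=
  [/\ E !=set0, compact E & E = \bigcup_(j in J) (f j @` E)].

(* E is meant to be the self-similar set of (f_j)_{j in J}. *)
Definition strong_separation {R : realType} {d : nat} {I : Type} (J : set I)
    (f : I -> 'cV[R]_d -> 'cV[R]_d) (E : set 'cV[R]_d) : Prop :=
  trivIset J (fun j => f j @` E).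

Definition orthogonal_mx {R : realType} {d : nat} (O : 'M[R]_d) : Prop :=
  O^T *m O = 1%:M.

Definition similarity_map {R : realType} {d : nat} (rho : R) (O : 'M[R]_d)
    (b x : 'cV[R]_d) : 'cV[R]_d :=
  rho *: (O *m x) + b.

Definition HSPl {R : realType} {d : nat} (l : nat) (K : set 'cV[R]_d) : Prop :=
  exists A : 'I_l -> set 'cV[R]_d,
    [/\ forall i, compact (A i),
        set_sum A `<=` K &
        forall i, dimH (A i) = dimH K].

Definition HSP {R : realType} {d : nat} (K : set 'cV[R]_d) : Prop :=
  forall l : nat, (2 <= l)%N -> HSPl l K.

(* Main.v *)
(* Every point of K has an expansion in powers of rho O with digits in D, and
   strong separation of Psi makes expansions of points of K - K unique. If
   K1 + K2 is contained in K, this forces the k-th digits available to K1 and K2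
   (up to translation) to satisfy P_k + Q_k c D + a_k, so P_k and Q_k cannot both
   have N = #D elements and #P_k #Q_k <= N^2 - 1. Covering K1 and K2 by cylinders
   of the same level n gives dim K1 + dim K2 <= ln (N^2 - 1) / - ln rho, whereas
   dim K >= ln N / - ln rho by a mass distribution argument. *)

Require Import Defs.
From HB Require Import structures.
From mathcomp Require Import all_boot all_order all_algebra finmap.
From mathcomp Require Import all_classical all_reals all_analysis.
From mathcomp Require Import lra.
Import Order.TTheory GRing.Theory Num.Theory.
Import numFieldNormedType.Exports.

Local Open Scope classical_set_scope.
Local Open Scope ring_scope.

(** * Euclidean norm against sup norm, and compactness of difference sets *)

Section EuclideanNorm.
Set Implicit Arguments.
Unset Strict Implicit.
Context {R : realType} {d : nat}.
Implicit Types (x y : 'cV[R]_d) (A B : set 'cV[R]_d).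

Lemma enorm_ge0 x : 0 <= enorm x.
Proof. exact: sqrtr_ge0. Qed.

Lemma enormZ a x : enorm (a *: x) = `|a| * enorm x.
Proof.
rewrite /enorm; under eq_bigr do rewrite mxE exprMn.
by rewrite -mulr_sumr sqrtrM ?sqr_ge0// sqrtr_sqr.
Qed.

Lemma enorm_orthogonal (O : 'M[R]_d) x :
  orthogonal_mx O -> enorm (O *m x) = enorm x.
Proof.
move=> hO; rewrite /enorm; congr Num.sqrt.
have sumE (y : 'cV[R]_d) : \sum_(i < d) y i ord0 ^+ 2 = (y^T *m y) ord0 ord0.
  by rewrite mxE; apply: eq_bigr => i _; rewrite mxE expr2.
by rewrite !sumE trmx_mul mulmxA -(mulmxA x^T) hO mulmx1.
Qed.

Lemma normr_coord_le x i : `|x i ord0| <= `|x|.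
Proof.
rewrite [leRHS]/Num.norm /= mx_normrE; apply/bigmax_geP; right.
by exists (i, ord0).
Qed.

Lemma enorm_le_normr x : enorm x <= d%:R * `|x|.
Proof.
rewrite -[leRHS]ger0_norm ?mulr_ge0// -sqrtr_sqr ler_sqrt ?sqr_ge0//.
apply: (@le_trans _ _ (\sum_(i < d) `|x| ^+ 2)).
  apply: ler_sum => i _; rewrite -[leLHS]real_normK ?num_real//.
  by rewrite lerXn2r ?nnegrE// normr_coord_le.
rewrite sumr_const card_ord -[leLHS]mulr_natl exprMn ler_wpM2r ?sqr_ge0//.
by rewrite -natrX ler_nat; case: d => // n; rewrite leq_pmulr.
Qed.

Lemma normr_le_enorm x : `|x| <= enorm x.
Proof.
rewrite [leLHS]/Num.norm /= mx_normrE; apply/bigmax_leP; split.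
  exact: enorm_ge0.
move=> [i j] _ /=; rewrite (ord1 j) -sqrtr_sqr ler_sqrt ?sumr_ge0//.
  by rewrite (bigD1 i)//= lerDl sumr_ge0// => k _; exact: sqr_ge0.
by move=> k _; exact: sqr_ge0.
Qed.

Lemma compact_set_sub A B : compact A -> compact B -> compact (set_sub A B).
Proof.
move=> cA cB.
have -> : set_sub A B = (fun z => z.1 - z.2) @` (A `*` B).
  apply/seteqP; split=> [_ [a Aa [b Bb <-]]|_ [[a b] [/= Aa Bb] <-]].
    by exists (a, b).
  by exists a => //; exists b.
apply: continuous_compact; last exact: compact_setX.
apply: continuous_subspaceT => z.
by apply: cvgB; [exact: cvg_fst|exact: cvg_snd].
Qed.

Lemma compact_enorm_bounded A : compact A ->
  exists2 M, 0 < M & forall x y, A x -> A y -> enorm (x - y) <= M.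
Proof.
move=> cA; have cAA := compact_set_sub cA cA.
have [M [_ hM]] := compact_bounded cAA.
exists (d%:R * (`|M| + 1) + 1).
  by rewrite ltr_wpDl// mulr_ge0// addr_ge0.
move=> x y Ax Ay; apply: le_trans (enorm_le_normr _) _.
apply: ler_wpDr => //; apply: ler_wpM2l => //; apply: hM.
  by rewrite (le_lt_trans (ler_norm M))// ltrDl.
by exists x => //; exists y.
Qed.

Lemma continuous_similarity_map (rho : R) (O : 'M[R]_d) b :
  orthogonal_mx O -> continuous (similarity_map rho O b).
Proof.
move=> hO x; apply/(@cvgrPdist_lt _ _ _ (nbhs x)) => e e0; near=> y.
rewrite /similarity_map opprD addrACA subrr addr0 -scalerBr -mulmxBr.
rewrite (le_lt_trans (normr_le_enorm _))// enormZ enorm_orthogonal//.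
have C0 : 0 < `|rho| * d%:R + 1 by rewrite ltr_wpDl// mulr_ge0.
apply: (@le_lt_trans _ _ ((`|rho| * d%:R + 1) * `|x - y|)).
  rewrite mulrDl mul1r ler_wpDr// -mulrA ler_wpM2l//.
  exact: enorm_le_normr.
rewrite mulrC -ltr_pdivlMr//; near: y.
by apply: cvgr_dist_lt; [exact: cvg_id|rewrite divr_gt0].
Unshelve. all: by end_near. Qed.

End EuclideanNorm.

(** * Counting digit pairs and avoiding words *)

Section DigitCombinatorics.
Set Implicit Arguments.
Unset Strict Implicit.

Lemma card_family_ord (T : finType) (n : nat) (P : nat -> {set T}) :
  #|family (fun i : 'I_n => mem (P i))| = (\prod_(i < n) #|P i|)%N.
Proof. by rewrite card_family foldrE big_map big_enum. Qed.

(** A product equal to [N ^ 2] would force both [P] and [Q] to be everything. Adding any [e j] would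
    then permute the alphabet up to the translation [a]; summing over the alphabet gives
    [N e j = N a], so [e] would be constant. *)
Lemma card_mul_translate_lt {V : zmodType} (N : nat) (e : 'I_N -> V) (a : V)
    (P Q : {set 'I_N}) :
    (2 <= N)%N -> injective e -> (forall v : V, v *+ N = 0 -> v = 0) ->
    (forall i j, i \in P -> j \in Q -> exists l, e i + e j = e l + a) ->
  (#|P| * #|Q| <= (N ^ 2).-1)%N.
Proof.
move=> N2 einj tf PQ; have N0 : (0 < N)%N by rewrite (leq_trans _ N2).
rewrite -ltnS prednK ?expn_gt0 ?N0// ltnNge; apply/negP => NPQ.
have leP (S : {set 'I_N}) : (#|S| <= N)%N by rewrite -[leqRHS]card_ord max_card.
have full (S S' : {set 'I_N}) : (N ^ 2 <= #|S| * #|S'|)%N -> S = [set: 'I_N]%SET.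
  move=> h; apply/eqP; rewrite eqEcard finset.subsetT cardsT card_ord/=.
  rewrite -(leq_pmul2r N0) (leq_trans h)// leq_mul2l.
  by rewrite leP orbT.
have PT := full _ _ NPQ; rewrite mulnC in NPQ; have QT := full _ _ NPQ.
have {PQ} PQ i j : exists l, e i + e j = e l + a by apply: PQ; rewrite ?PT ?QT.
have ea j : e j = a.
  have [f fE] := choice (fun i => PQ i j).
  have finj : injective f.
    move=> i i' ff; apply: einj; apply: (addIr (e j)).
    by rewrite !fE ff.
  apply/eqP; rewrite -subr_eq0; apply/eqP; apply: tf.
  have : \sum_i (e i + e j) = \sum_i (e i + a).
    rewrite [RHS](reindex_inj finj)/=.
    by apply: eq_bigr.
  rewrite !big_split/= => /addrI; rewrite !sumr_const card_ord => h.
  by rewrite mulrnBl h subrr.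
have : Ordinal N0 = Ordinal N2 by apply: einj; rewrite !ea.
by move=> /(congr1 val).
Qed.

(* A Borel-Cantelli type argument on the tree of words: starting from the
   empty word, keep choosing a letter such that the words [w i] extending the
   current word [v] have total weight less than [N ^- size v]. *)
Lemma exists_avoiding_sequence {R : realType} (N : nat) (k : nat -> nat)
    (w : nat -> nat -> 'I_N) :
    (0 < N)%N -> (\sum_(0 <= i <oo) (N%:R ^- k i : R)%:E < 1)%E ->
  exists a : nat -> 'I_N, forall i, exists2 j, (j < k i)%N & a j != w i j.
Proof.
move=> N0 sum1; have N0R : 0 < N%:R :> R by rewrite ltr0n.
have F0 i : (0 <= (N%:R ^- k i : R)%:E)%E.
  by rewrite lee_fin invr_ge0 exprn_ge0// ltW.
pose ext (v : seq 'I_N) i := (size v <= k i)%N && (v == mkseq (w i) (size v)).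
pose S v := (\sum_(0 <= i <oo | ext v i) (N%:R ^- k i : R)%:E)%E.
pose light v := (S v < (N%:R ^- size v)%:E)%E.
(* If [v] were itself one of the words, that single term would already weigh [N ^- size v]. *)
have light_strict v i : light v -> ext v i -> (size v < k i)%N.
  move=> lv evi; have := evi; rewrite {1}/ext => /andP[].
  rewrite leq_eqVlt => /predU1P[kE _|//].
  move: lv; rewrite /light kE ltNge => /negP[].
  rewrite /S (nneseriesD1 (fun j _ => F0 j) evi) leeDl//.
  by apply: nneseries_ge0 => j _ _; exact: F0.
(* A word properly extending [v] extends exactly one child of [v], so the children share out [S v].
   If none were light, [S v] would be at least [N * N ^- (size v).+1 = N ^- size v]. *)
have step v : light v -> exists b, light (rcons v b).
  move=> lv; apply: contrapT => /forallNP nl.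
  have : (\sum_(b < N) (N%:R ^- (size v).+1 : R)%:E <= \sum_(b < N) S (rcons v b))%E.
    apply: lee_sum => b _; move: (nl b) => /negP; rewrite /light -leNgt.
    by rewrite size_rcons.
  rewrite /S; under [X in (_ <= X)%E]eq_bigr do rewrite eseries_mkcond.
  rewrite -nneseries_sum; last by move=> b j _; case: ifP.
  rewrite sumEFin sumr_const card_ord -[_ *+ N]mulr_natl exprS invfM mulrA.
  rewrite divff ?gt_eqF// mul1r.
  suff -> : (\sum_(0 <= j <oo) (\sum_(b < N)
      (if ext (rcons v b) j then (N%:R ^- k j : R)%:E else 0)) = S v)%E.
    by move: lv; rewrite /light ltNge => /negP.
  rewrite /S [RHS]eseries_mkcond; apply: eq_eseriesr => j _.
  case: ifPn => [evj|nevj]; last first.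
    rewrite big1// => b _; rewrite ifF//; apply: contraNF nevj.
    rewrite /ext size_rcons => /andP[/ltnW -> /=].
    by rewrite mkseqS eqseq_rcons => /andP[].
  have lt := light_strict _ _ lv evj.
  have extE b : ext (rcons v b) j = (b == w j (size v)).
    rewrite /ext size_rcons lt mkseqS eqseq_rcons.
    by move: evj => /andP[_ ->].
  rewrite (bigD1 (w j (size v)))//= extE eqxx big1 ?adde0// => b bw.
  by rewrite extE (negbTE bw).
have step_total v : exists b, light v -> light (rcons v b).
  have [/step[b lb]|nlv] := pselect (light v); first by exists b.
  by exists (Ordinal N0).
have [next nextP] := choice step_total.
pose v n := iter n (fun u => rcons u (next u)) [::].
pose a n := next (v n).
have vE n : v n = mkseq a n.
  by elim: n => [//|n IH]; rewrite mkseqS -IH.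
have lv n : light (v n).
  elim: n => [|n /nextP//]; rewrite /light /= expr0 invr1.
  by apply: le_lt_trans sum1; apply: subset_lee_nneseries.
exists a => i; apply: contrapT => h.
have aw j : (j < k i)%N -> a j = w i j.
  by move=> jk; apply/eqP/negP => /negP ne; apply: h; exists j.
have evi : ext (v (k i)) i.
  rewrite /ext vE size_mkseq leqnn/=; apply/eqP.
  apply: (@eq_from_nth _ (Ordinal N0)); rewrite !size_mkseq// => j jk.
  by rewrite !nth_mkseq// aw.
by have := light_strict _ _ (lv (k i)) evi; rewrite vE size_mkseq ltnn.
Qed.

End DigitCombinatorics.

(** * Upper and lower bounds for Hausdorff dimension *)

Section HausdorffDimension.
Set Implicit Arguments.
Unset Strict Implicit.
Context {R : realType} {d : nat}.
Implicit Types (A U : set 'cV[R]_d) (s : R).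

Lemma dimH_ge0 A : (0 <= dimH A)%E.
Proof. by apply: le_ereal_inf_tmp => _ [s [s0 _] <-]; rewrite lee_fin. Qed.

Lemma diam_set0 : diam (set0 : set 'cV[R]_d) = -oo%E.
Proof.
rewrite /diam (_ : [set _ | _ in _ & _ in _] = set0) ?ereal_sup0//.
by apply/seteqP; split => // e [? []].
Qed.

Lemma enorm_le_diam U x y : U x -> U y -> ((enorm (x - y))%:E <= diam U)%E.
Proof. by move=> Ux Uy; apply: ereal_sup_ubound; exists x => //; exists y. Qed.

Lemma diam_ge0 U : U !=set0 -> (0 <= diam U)%E.
Proof.
move=> [x Ux]; apply: le_trans (enorm_le_diam Ux Ux).
by rewrite lee_fin enorm_ge0.
Qed.

Lemma diam_le U r :
  (forall x y, U x -> U y -> enorm (x - y) <= r) -> (diam U <= r%:E)%E.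
Proof.
move=> h; apply: ge_ereal_sup => _ [x Ux [y Uy <-]].
by rewrite lee_fin h.
Qed.

Lemma diam_pow_ge0 s U : (0 <= diam_pow s U)%E.
Proof. by rewrite /diam_pow; case: ifP => // _; exact: poweR_ge0. Qed.

Lemma diam_pow_le s r U : 0 <= s -> (diam U <= r%:E)%E ->
  (diam_pow s U <= (r `^ s)%:E)%E.
Proof.
move=> s0 Ur; rewrite /diam_pow; case: ifPn => [_|/set0P U0].
  by rewrite lee_fin powR_ge0.
have dU := diam_ge0 U0; rewrite -poweR_EFin.
by apply: gt0_ler_poweR => //; rewrite in_itv/= leey andbT// (le_trans dU).
Qed.

Lemma hausdorff_premeasure_ge0 s delta A :
  (0 <= hausdorff_premeasure s delta A)%E.
Proof.
apply: le_ereal_inf_tmp => _ [U _ <-]; apply: nneseries_ge0 => n _ _.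
exact: diam_pow_ge0.
Qed.

Lemma hausdorff_premeasure_le_measure s delta A : 0 < delta ->
  (hausdorff_premeasure s delta A <= hausdorff_measure s A)%E.
Proof. by move=> d0; apply: ereal_sup_ubound; exists delta. Qed.

(** Padding a finite cover with empty sets, which [diam_pow] sends to 0 even when [s = 0], bounds
    every premeasure by [eps], so the [s]-measure vanishes. *)
Lemma dimH_le_of_covers A s : 0 <= s ->
    (forall eps, 0 < eps -> exists (m : nat) (r : R) (U : nat -> set 'cV[R]_d),
      [/\ r <= eps, m%:R * r `^ s <= eps, A `<=` \bigcup_(i in `I_m) U i &
          forall i x y, U i x -> U i y -> enorm (x - y) <= r]) ->
  (dimH A <= s%:E)%E.
Proof.
move=> s0 cov; apply: ereal_inf_lbound; exists s => //; split => //.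
apply/eqP; rewrite eq_le; apply/andP; split; last first.
  exact: le_trans (hausdorff_premeasure_ge0 _ _ _)
    (hausdorff_premeasure_le_measure _ _ ltr01).
apply: ge_ereal_sup => _ [delta /= delta0 <-].
apply/lee_addgt0Pr => eps eps0; rewrite add0e.
have min0 : 0 < Num.min delta eps by rewrite lt_min delta0.
have [m [r [U [rle mr AU Ur]]]] := cov _ min0.
pose V i := if (i < m)%N then U i else set0.
have dV i : (diam (V i) <= r%:E)%E.
  rewrite /V; case: ifP => _; last by rewrite diam_set0 leNye.
  by apply: diam_le; exact: Ur.
apply: (@le_trans _ _ (\sum_(0 <= i <oo) diam_pow s (V i))%E).
  apply: ereal_inf_lbound; exists V => //; split=> [x Ax|i].
    by have [i /= im Uix] := AU _ Ax; exists i => //; rewrite /V im.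
  by apply: le_trans (dV i) _; rewrite lee_fin (le_trans rle)// ge_min lexx.
rewrite (@nneseries_split _ _ 0 m); last by move=> *; exact: diam_pow_ge0.
rewrite add0n [X in (_ + X)%E]eseries0 ?adde0; last first.
  by move=> i mi _; rewrite /V ltnNge mi /diam_pow eqxx.
apply: (@le_trans _ _ (\sum_(0 <= i < m) (r `^ s)%:E)%E).
  by apply: lee_sum => i _; exact: diam_pow_le.
rewrite sumEFin lee_fin sumr_const_nat subn0 -[_ *+ m]mulr_natl.
by rewrite (le_trans mr)// ge_min lexx orbT.
Qed.

(* Mass distribution principle for the uniform measure on codes: a cover with
   small sum of [diam ^ s] would give words of total weight less than 1, and an
   avoiding sequence codes a point of [K] outside the cover. *)
Lemma le_dimH_of_coding (K : set 'cV[R]_d) (N : nat)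
    (code : 'cV[R]_d -> nat -> 'I_N) (rho eps t : R) :
    (2 <= N)%N -> 0 < rho < 1 -> 0 < eps -> rho `^ t = N%:R^-1 ->
    (forall a, exists2 x, K x & code x = a) ->
    (forall x y k, K x -> K y -> enorm (x - y) < rho ^+ k * eps ->
      forall j, (j <= k)%N -> code x j = code y j) ->
  (t%:E <= dimH K)%E.
Proof.
move=> N2 /andP[rho0 rho1] eps0 rhot surj sep.
have N0 : (0 < N)%N by rewrite (leq_trans _ N2).
apply: le_ereal_inf_tmp => _ [s [s0 Hs0] <-].
rewrite lee_fin leNgt; apply/negP => st.
have rhosN : N%:R^-1 <= rho `^ s.
  by rewrite -rhot; apply: ger_powR; [rewrite rho0 ltW|exact: ltW].
pose C := ((rho * eps) `^ s)^-1.
have re0 : 0 < (rho * eps) `^ s by rewrite powR_gt0// mulr_gt0.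
have C0 : 0 < C by rewrite invr_gt0.
(* Half of the unit weight goes to [C] times the sum of [diam ^ s], the other half to error terms
   [2 ^- (i + 2)]. The scale [eps / 2] keeps diameters below [eps], the separation at level 0. *)
have : (hausdorff_premeasure s (eps / 2) K < (2^-1 / C)%:E)%E.
  apply: le_lt_trans (hausdorff_premeasure_le_measure _ _ _) _.
    by rewrite divr_gt0.
  by rewrite Hs0 lte_fin divr_gt0.
move=> /ereal_inf_lt[_ [U [KU dU] <-]] sumU.
(* Each [U i] gets a word: the first [k] letters common to the codes of all points of [K] in
   [U i]. *)
have kw i : exists kw : nat * (nat -> 'I_N),
    (forall x j, K x -> U i x -> (j < kw.1)%N -> code x j = kw.2 j) /\
    ((N%:R ^- kw.1 : R)%:E <= C%:E * diam_pow s (U i) + (1 / (2 ^ (i + 2))%:R)%:E)%E.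
  have [k [sepk lek]] : exists k,
    (forall x y, K x -> K y -> U i x -> U i y -> enorm (x - y) < rho ^+ k * eps) /\
    ((N%:R ^- k : R)%:E <= C%:E * diam_pow s (U i) + (1 / (2 ^ (i + 2))%:R)%:E)%E.
    (* A set with at most one point allows every level; [i + 2] makes its weight at most the error
       term, which is needed because [diam ^ s] may be 0. *)
    have [d0|d0] := leP (diam (U i)) 0%E.
      exists (i + 2)%N; split=> [x y _ _ Ux Uy|].
        rewrite (@le_lt_trans _ _ 0)//; last by rewrite mulr_gt0// exprn_gt0.
        by rewrite -lee_fin (le_trans (enorm_le_diam Ux Uy)).
      apply: (@le_trans _ _ (1 / (2 ^ (i + 2))%:R)%:E); last first.
        by rewrite leeDr// mule_ge0// ?diam_pow_ge0// lee_fin ltW.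
      rewrite lee_fin div1r natrX lef_pV2 ?posrE ?exprn_gt0 ?ltr0n//.
      by rewrite lerXn2r ?nnegrE// ler_nat.
    have Ui0 : U i != set0 by apply: contraTneq d0 => ->; rewrite diam_set0.
    have [r dr] : exists r, diam (U i) = r%:E.
      by move: d0 (dU i); case: (diam (U i)) => // r _ _; exists r.
    rewrite dr lte_fin in d0.
    have rlt : r < eps.
      have := dU i; rewrite dr lee_fin => /le_lt_trans; apply.
      by rewrite ltr_pdivrMr// ltr_pMr// ltr1n.
    (* The least such [k] satisfies [r < rho ^+ k * eps], which gives separation, while
       [rho ^+ k.+1 * eps <= r] gives the weight bound through [N^-1 <= rho ^ s]. *)
    have exk : exists k, rho ^+ k.+1 * eps <= r.
      have : (fun k => rho ^+ k) @ \oo --> (0 : R).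
        by apply: cvg_expr; rewrite ger0_norm ?ltW.
      move=> /cvgrPdist_lt/(_ (r / eps)); rewrite divr_gt0// => /(_ isT)[n _ h].
      exists n; have := h n.+1 (leqnSn n).
      rewrite /= sub0r normrN ger0_norm ?(exprn_ge0 _ (ltW rho0))//.
      rewrite ltr_pdivlMr//.
      exact: ltW.
    case: (ex_minnP exk) => k kle kmin; exists k; split=> [x y _ _ Ux Uy|].
      have : enorm (x - y) <= r by rewrite -lee_fin -dr enorm_le_diam.
      move=> /le_lt_trans; apply.
      case: k kmin {kle} => [_|k kmin]; first by rewrite expr0 mul1r.
      by rewrite ltNge; apply/negP => /kmin; rewrite ltnn.
    rewrite /diam_pow (negbTE Ui0) dr poweR_EFin -EFinM -EFinD lee_fin.
    rewrite ler_wpDr ?divr_ge0// /C mulrC ler_pdivlMr//.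
    apply: (@le_trans _ _ ((rho ^+ k.+1 * eps) `^ s)); last first.
      rewrite ge0_ler_powR ?nnegrE// ?(ltW d0)// mulr_ge0 ?exprn_ge0 ?ltW//.
    have -> : (rho ^+ k.+1 * eps) `^ s = (rho `^ s) ^+ k * (rho * eps) `^ s.
      rewrite exprSr -mulrA powRM ?exprn_ge0 ?mulr_ge0 ?ltW//; congr (_ * _).
      by rewrite -!powR_mulrn ?powR_ge0 ?(ltW rho0)// powRAC.
    rewrite ler_wpM2r ?(ltW re0)// -exprVn lerXn2r ?nnegrE ?powR_ge0//.
  have [[y [Ky Uy]]|none] := pselect (exists y, K y /\ U i y).
    exists (k, code y); split=> //= x j Kx Ux jk.
    by apply: (sep _ _ k) => //; [exact: sepk|exact: ltnW].
  exists (k, fun=> Ordinal N0); split=> //= x j Kx Ux; exfalso; apply: none.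
  by exists x.
have [f fP] := choice kw.
have [|a aP] := @exists_avoiding_sequence R N (fun i => (f i).1) (fun i => (f i).2) N0.
  apply: (@le_lt_trans _ _ (\sum_(0 <= i <oo)
      (C%:E * diam_pow s (U i) + (1 / (2 ^ (i + 2))%:R)%:E))%E).
    apply: lee_nneseries => i *; last by have [] := fP i.
    by rewrite lee_fin invr_ge0 exprn_ge0.
  rewrite nneseriesD; first last.
  - by move=> *; rewrite lee_fin divr_ge0.
  - by move=> *; rewrite mule_ge0 ?diam_pow_ge0// lee_fin ltW.
  rewrite nneseriesZl; last by move=> *; exact: diam_pow_ge0.
  have -> : (\sum_(0 <= i <oo) (1 / (2 ^ (i + 2))%:R)%:E = (2^-1)%:E :> \bar R)%E.
    by have /cvg_lim := @cvg_geometric_eseries_half R 1 1; rewrite expr1 div1r; apply.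
  have -> : 1%E = ((2^-1)%:E + (2^-1)%:E)%E :> \bar R.
    by rewrite -EFinD -[2^-1]div1r -splitr.
  by rewrite lteD2rE// muleC -lte_pdivlMr// mulrC.
have [x Kx xa] := surj a; have [i _ Uix] := KU _ Kx.
have [j jk] := aP i; rewrite -xa.
by have [/(_ x j Kx Uix jk) -> _] := fP i; rewrite eqxx.
Qed.

End HausdorffDimension.

(** * Self-similarity of [K - K] and unique first digits *)

Section SelfSimilarDifferences.
Set Implicit Arguments.
Unset Strict Implicit.
Context {R : realType} {d : nat} (rho : R) (O : 'M[R]_d).
Hypotheses (rho0 : 0 < rho) (rho1 : rho < 1) (hO : orthogonal_mx O).
Local Notation f := (similarity_map rho O).

Lemma similarity_map_sub b c x y : f b x - f c y = f (b - c) (x - y).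
Proof. by rewrite /similarity_map mulmxBr scalerBr opprD addrACA. Qed.

Lemma enorm_similarity_map_sub b x y : enorm (f b x - f b y) = rho * enorm (x - y).
Proof.
rewrite similarity_map_sub subrr /similarity_map addr0 enormZ.
by rewrite enorm_orthogonal// ger0_norm// ltW.
Qed.

Lemma similarity_map_inj b : injective (f b).
Proof.
move=> x y xy; apply/eqP; rewrite -subr_eq0 -normr_le0.
apply: le_trans (normr_le_enorm _) _.
have := enorm_similarity_map_sub b x y; rewrite xy subrr.
rewrite /enorm; under eq_bigr do rewrite mxE expr0n/=.
rewrite big1// sqrtr0 => /esym/eqP.
by rewrite mulf_eq0 gt_eqF//= => /eqP ->.
Qed.

Lemma self_similar_set_sub (D K : set 'cV[R]_d) :
  self_similar_set D f K -> self_similar_set (set_sub D D) f (set_sub K K).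
Proof.
move=> [[x Kx] cK KE]; split.
- by exists (x - x); exists x => //; exists x.
- exact: compact_set_sub.
- apply/seteqP; split=> [_ [y Ky [z Kz <-]]|u [_ [b Db [c Dc <-]]]].
    move: Ky Kz; rewrite {1 2}KE => -[b Db [y' Ky' <-]] [c Dc [z' Kz' <-]].
    exists (b - c); first by exists b => //; exists c.
    exists (y' - z'); first by exists y' => //; exists z'.
    by rewrite similarity_map_sub.
  move=> [_ [y Ky [z Kz <-]] <-]; exists (f b y).
    by rewrite KE; exists b => //; exists y.
  exists (f c z); first by rewrite KE; exists c => //; exists z.
  by rewrite similarity_map_sub.
Qed.

Context (N : nat) (e : 'I_N -> 'cV[R]_d) (K : set 'cV[R]_d).
Hypotheses (N2 : (2 <= N)%N) (einj : injective e).
Hypothesis hK : self_similar_set (range e) f K.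
Hypothesis ssc : strong_separation (set_sub (range e) (range e)) f (set_sub K K).

Let N0 : (0 < N)%N. Proof. exact: leq_trans N2. Qed.
Let cK : compact K. Proof. by case: hK. Qed.

Lemma similarity_map_stable i x : K x -> K (f (e i) x).
Proof.
by case: hK => _ _ KE Kx; rewrite KE; exists (e i); [exists i|exists x].
Qed.

(** Both sides lie in pieces of [K - K]; disjointness identifies the digit differences, and
    injectivity of the common map identifies the remainders. *)
Lemma ssc_unique i j i' j' x y x' y' : K x -> K y -> K x' -> K y' ->
    f (e i) x - f (e j) y = f (e i') x' - f (e j') y' ->
  e i - e j = e i' - e j' /\ x - y = x' - y'.
Proof.
move=> Kx Ky Kx' Ky'; rewrite !similarity_map_sub => E.
have De k l : set_sub (range e) (range e) (e k - e l).
  by exists (e k); [exists k|exists (e l) => //; exists l].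
have KK u v : K u -> K v -> set_sub K K (u - v).
  by move=> Ku Kv; exists u => //; exists v.
have tE : e i - e j = e i' - e j'.
  apply: (ssc (De _ _) (De _ _)); exists (f (e i - e j) (x - y)); split.
    by exists (x - y) => //; exact: KK.
  by rewrite E; exists (x' - y') => //; exact: KK.
by split=> //; move: E; rewrite tE => /similarity_map_inj.
Qed.

(** Choice provides total functions, with arbitrary values off [K], so that [T] can be iterated as a
    left shift on expansions. *)
Lemma exists_digit_and_shift : exists (dig : 'cV[R]_d -> 'I_N)
    (T : 'cV[R]_d -> 'cV[R]_d),
  forall x, K x -> K (T x) /\ x = f (e (dig x)) (T x).
Proof.
have step x : exists p : 'I_N * 'cV[R]_d,
    K x -> K p.2 /\ x = f (e p.1) p.2.
  have [Kx|nKx] := pselect (K x); last by exists (Ordinal N0, 0).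
  case: hK => _ _ KE; move: (Kx); rewrite {1}KE => -[_ [i _ <-] [y Ky yx]].
  by exists (i, y).
have [p pP] := choice step.
by exists (fun x => (p x).1), (fun x => (p x).2).
Qed.

(** * Digit sequences of points of [K] *)

Context (dig : 'cV[R]_d -> 'I_N) (T : 'cV[R]_d -> 'cV[R]_d).
Hypothesis digT : forall x, K x -> K (T x) /\ x = f (e (dig x)) (T x).

(** For [x] in [K], this is the index of the digit multiplied by the [j]-th power of [rho O] in the
    expansion of [x]. *)
Definition itinerary x j := dig (iter j T x).

Lemma itineraryS x j : itinerary x j.+1 = itinerary (T x) j.
Proof. by rewrite /itinerary iterSr. Qed.

Lemma iter_shift_stable x n : K x -> K (iter n T x).
Proof. by move=> Kx; elim: n => // n /digT[]. Qed.

(** Uniqueness for differences yields uniqueness for points: the difference of two representations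
    of one point is compared with a trivial difference. *)
Lemma dig_shift_similarity_map i x : K x ->
  dig (f (e i) x) = i /\ T (f (e i) x) = x.
Proof.
move=> Kx; have [KT E] := digT (similarity_map_stable i Kx).
set z := f (e i) x in KT E *.
have : f (e (dig z)) (T z) - f (e i) x = f (e i) x - f (e i) x.
  by rewrite -E.
move=> /(ssc_unique KT Kx Kx Kx)[]; rewrite !subrr => /eqP + /eqP.
by rewrite !subr_eq0 => /eqP/einj -> /eqP ->.
Qed.

Lemma itinerary_sub x y x' y' j : K x -> K y -> K x' -> K y' ->
    x - y = x' - y' ->
  e (itinerary x j) - e (itinerary y j) =
  e (itinerary x' j) - e (itinerary y' j).
Proof.
elim: j x y x' y' => [|j IH] x y x' y' Kx Ky Kx' Ky' E.
all: have [[KTx xE] [KTy yE]] := (digT Kx, digT Ky).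
all: have [[KTx' xE'] [KTy' yE']] := (digT Kx', digT Ky').
all: have [] := @ssc_unique (dig x) (dig y) (dig x') (dig y')
       (T x) (T y) (T x') (T y') KTx KTy KTx' KTy'.
all: rewrite -?xE -?yE -?xE' -?yE' //.
by move=> _ /IH; rewrite !itineraryS; apply.
Qed.

(** Points with different first digits differ by an element of [C], the union of the pieces of
    [K - K] with nonzero digit. [C] is closed and misses 0, because 0 lies in the piece with digit
    0; hence a ball around 0 avoids [C]. *)
Lemma digit_gap : exists2 eps, 0 < eps &
  forall x y, K x -> K y -> enorm (x - y) < eps -> dig x = dig y.
Proof.
have [KK0 cKK _] := self_similar_set_sub hK.
pose D0 := set_sub (range e) (range e) `\ 0.
pose C := \bigcup_(t in D0) (f t @` set_sub K K).
have fD0 : finite_set D0.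
  apply: finite_setD; apply: (@sub_finite_set _ _
    (range (fun p : 'I_N * 'I_N => e p.1 - e p.2))); last first.
    exact/finite_image/finite_finset.
  by move=> _ [_ [i _ <-] [_ [j _ <-] <-]]; exists (i, j).
have clC : closed C.
  apply: closed_bigcup => // t _; apply: compact_closed.
    exact: norm_hausdorff.
  apply: continuous_compact => //; apply: continuous_subspaceT.
  exact: continuous_similarity_map.
have C0 : (~` C) 0.
  move=> [t [[b Db [c Dc bct]] /= t0] [u KKu tu0]]; apply: t0.
  apply: (ssc (i := t) (j := 0)); first by exists b => //; exists c.
    by exists b => //; exists b => //; rewrite subrr.
  exists 0; split; first by exists u.
  have [x Kx] := let: And3 h _ _ := hK in h.
  exists 0; first by exists x => //; exists x => //; rewrite subrr.
  by rewrite /similarity_map mulmx0 scaler0 addr0.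
have /nbhs_ballP[eps /= eps0 epsC] : nbhs (0 : 'cV[R]_d) (~` C).
  by apply: open_nbhs_nbhs; split => //; exact: closed_openC.
exists eps => // x y Kx Ky xy; apply/eqP/negP => /negP ne.
have [[KTx xE] [KTy yE]] := (digT Kx, digT Ky).
apply: (epsC (x - y)).
  rewrite -ball_normE /= sub0r normrN.
  exact: le_lt_trans (normr_le_enorm _) xy.
exists (e (dig x) - e (dig y)).
  split; first by exists (e (dig x)) => //; exists (e (dig y)).
  by move=> /= /eqP; rewrite subr_eq0 => /eqP/einj/eqP; rewrite (negbTE ne).
exists (T x - T y); first by exists (T x) => //; exists (T y).
by rewrite -similarity_map_sub -xE -yE.
Qed.

Lemma enorm_shift_sub x y : K x -> K y -> dig x = dig y ->
  enorm (x - y) = rho * enorm (T x - T y).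
Proof.
move=> Kx Ky xy; have [[KTx xE] [KTy yE]] := (digT Kx, digT Ky).
by rewrite {1}xE {1}yE xy enorm_similarity_map_sub.
Qed.

Lemma enorm_iter_shift_sub n x y : K x -> K y ->
    (forall j, (j < n)%N -> itinerary x j = itinerary y j) ->
  enorm (x - y) = rho ^+ n * enorm (iter n T x - iter n T y).
Proof.
elim: n x y => [|n IH] x y Kx Ky xy; first by rewrite mul1r.
have [[KTx _] [KTy _]] := (digT Kx, digT Ky).
rewrite enorm_shift_sub//; last exact: (xy 0%N).
rewrite exprS -mulrA !iterSr; congr (_ * _); apply: IH => // j jn.
by rewrite -!itineraryS xy.
Qed.

(** While first digits agree, each shift expands distances by exactly [rho^-1], so [digit_gap] can
    be applied [k + 1] times. *)
Lemma itinerary_gap : exists2 eps, 0 < eps & forall x y k, K x -> K y ->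
  enorm (x - y) < rho ^+ k * eps ->
  forall j, (j <= k)%N -> itinerary x j = itinerary y j.
Proof.
have [eps eps0 gap] := digit_gap; exists eps => // x y k.
have rk m : rho ^+ m <= 1 by rewrite exprn_ile1// ltW.
elim: k x y => [|k IH] x y Kx Ky xy j.
  by rewrite leqn0 => /eqP ->; apply: gap => //; rewrite -[ltRHS]mul1r.
have dxy : dig x = dig y.
  by apply: gap => //; rewrite (lt_le_trans xy)// ler_piMl// ltW.
have [[KTx _] [KTy _]] := (digT Kx, digT Ky).
case: j => [//|j] jk; rewrite !itineraryS; apply: IH => //.
by move: xy; rewrite enorm_shift_sub// exprS -mulrA ltr_pM2l.
Qed.

(** Points of [K] realising longer and longer prefixes of [a] cluster in [K]; by [itinerary_gap] the
    cluster point inherits every digit. *)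
Lemma itinerary_surj (a : nat -> 'I_N) : exists2 x, K x & itinerary x = a.
Proof.
have [x0 Kx0] : K !=set0 by case: hK.
pose pt (l : seq 'I_N) := foldr (fun i => f (e i)) x0 l.
have Kpt l : K (pt l) by elim: l => //= i l; exact: similarity_map_stable.
have ptE i0 l j : (j < size l)%N -> itinerary (pt l) j = nth i0 l j.
  elim: l j => // i l IH [_|j jl] /=.
    by have [] := dig_shift_similarity_map i (Kpt l).
  rewrite itineraryS; have [_ ->] := dig_shift_similarity_map i (Kpt l).
  exact: IH.
pose u n := pt (mkseq a n).
have [x [Kx ux]] : K `&` cluster (u @ \oo) !=set0.
  by apply: cK; exists 0%N => // n _; exact: Kpt.
exists x => //; apply/funext => k.
have [eps eps0 gap] := itinerary_gap.
have d1 : 0 < d%:R + 1 :> R by rewrite ltr_wpDl.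
(* Balls are taken in the sup norm; dividing by [d + 1] makes the Euclidean distance smaller than
   [rho ^+ k * eps]. *)
pose r := rho ^+ k * eps / (d%:R + 1).
have r0 : 0 < r by rewrite divr_gt0// mulr_gt0// exprn_gt0.
have FB : (u @ \oo) [set u n | n in [set n | (k < n)%N]].
  by exists k.+1 => // n kn; exists n.
have [_ [[n kn <-]]] := ux _ _ FB (nbhsx_ballx x r r0).
rewrite -ball_normE /= => xun.
rewrite (gap x (u n) k Kx (Kpt _))//; last first.
  apply: le_lt_trans (enorm_le_normr _) _.
  apply: (@le_lt_trans _ _ ((d%:R + 1) * `|x - u n|)).
    by rewrite ler_wpM2r// lerDl.
  by rewrite mulrC -ltr_pdivlMr.
by rewrite (ptE (a k)) ?size_mkseq// nth_mkseq.
Qed.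

(** * Dimension bounds from digit counts *)

Lemma le_dimH_self_similar t : rho `^ t = N%:R^-1 -> (t%:E <= dimH K)%E.
Proof.
have [eps eps0 gap] := itinerary_gap; move=> ht.
apply: (le_dimH_of_coding (code := itinerary) (rho := rho) (eps := eps)) => //.
  by rewrite rho0.
exact: itinerary_surj.
Qed.

(** Level-[n] cylinders have diameter at most [rho ^+ n * M], so when at most [rho ^ (- c n)] of
    them are needed the [s]-sum is at most [rho ^ ((s - c) n) * M ^ s], which tends to 0.
    Arbitrarily large good levels suffice. *)
Lemma dimH_le_of_digits (B : set 'cV[R]_d) v (P : nat -> {set 'I_N}) (c s : R) :
    B !=set0 -> (forall x, B x -> K (x + v)) ->
    (forall x k, B x -> itinerary (x + v) k \in P k) -> c < s ->
    (forall n0, exists2 n, (n0 <= n)%N &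
      (\prod_(k < n) #|P k|)%:R <= (rho `^ (- c)) ^+ n) ->
  (dimH B <= s%:E)%E.
Proof.
move=> [x0 Bx0] BK BP cs often.
(* As [B] is nonempty, every [P k] is nonempty and the count is at least 1; at a level [n >= 1] this
   excludes [c < 0]. *)
have s0 : 0 < s.
  apply: le_lt_trans cs; rewrite leNgt; apply/negP => c0.
  have [n n0 ] := often 1%N.
  apply/negP; rewrite -ltNge; apply: (@lt_le_trans _ _ 1).
    rewrite exprn_ilt1 ?powR_ge0 -?lt0n//.
    rewrite /powR gt_eqF// -expR0 ltr_expR mulNr oppr_lt0 nmulr_rgt0//.
    by rewrite ln_lt0// rho0.
  rewrite (_ : 1 = 1%:R)// ler_nat; apply: prodn_gt0 => k.
  by apply/card_gt0P; exists (itinerary (x0 + v) k); exact: BP.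
have [M M0 KM] := compact_enorm_bounded cK.
apply: dimH_le_of_covers; first exact: ltW.
move=> eps eps0.
have cvg1 : (fun n => rho ^+ n * M) @ \oo --> (0 : R).
  rewrite -[X in _ --> X](mul0r M); apply: cvgMl.
  by apply: cvg_expr; rewrite ger0_norm ?ltW.
have q1 : 0 <= rho `^ (s - c) < 1.
  rewrite powR_ge0 /powR gt_eqF// -expR0 ltr_expR nmulr_llt0 ?subr_gt0//.
  by rewrite ln_lt0// rho0.
have cvg2 : (fun n => (rho `^ (s - c)) ^+ n * M `^ s) @ \oo --> (0 : R).
  rewrite -[X in _ --> X](mul0r (M `^ s)); apply: cvgMl.
  by apply: cvg_expr; case/andP: q1 => q0 q1; rewrite ger0_norm.
move/cvgrPdist_lt: cvg1 => /(_ eps eps0)[n1 _ h1].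
move/cvgrPdist_lt: cvg2 => /(_ eps eps0)[n2 _ h2].
have [n nge le_n] := often (maxn n1 n2).
pose W := family (fun i : 'I_n => mem (P i)).
pose w0 : {ffun 'I_n -> 'I_N} := [ffun=> Ordinal N0].
(* The pieces group points by their first [n] digits. Indices past [#|W|] repeat the piece of [w0],
   which obeys the same diameter bound. *)
exists #|W|, (rho ^+ n * M), (fun i => [set x | B x /\
  [ffun j : 'I_n => itinerary (x + v) j] = nth w0 (enum W) i]).
split.
- have rnM : 0 <= rho ^+ n * M by rewrite mulr_ge0 ?exprn_ge0 ?ltW.
  have := h1 n (leq_trans (leq_maxl _ _) nge).
  by rewrite /= sub0r normrN ger0_norm// => /ltW.
- have := h2 n (leq_trans (leq_maxr _ _) nge).
  rewrite /= sub0r normrN ger0_norm ?mulr_ge0 ?exprn_ge0 ?powR_ge0// => /ltW.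
  apply: le_trans; rewrite card_family_ord.
  rewrite powRM ?(exprn_ge0 _ (ltW rho0)) ?(ltW M0)// mulrA ler_wpM2r ?powR_ge0//.
  rewrite -powR_mulrn ?(ltW rho0)// powRAC powR_mulrn ?powR_ge0//.
  rewrite [s - c]addrC (powRD (x := rho)) ?(gt_eqF rho0) ?implybT//.
  by rewrite exprMn ler_wpM2r// exprn_ge0// powR_ge0.
- move=> x Bx; set w := [ffun j : 'I_n => itinerary (x + v) j].
  have Ww : w \in enum W.
    by rewrite mem_enum; apply/familyP => j; rewrite ffunE; exact: BP.
  exists (index w (enum W)); first by rewrite /= cardE index_mem.
  by split=> //; rewrite nth_index.
- move=> i x y [Bx <-] [By /ffunP xy].
  have -> : x - y = (x + v) - (y + v) by rewrite opprD addrACA subrr addr0.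
  have xyn j : (j < n)%N -> itinerary (x + v) j = itinerary (y + v) j.
    by move=> jn; have := xy (Ordinal jn); rewrite !ffunE.
  rewrite (enorm_iter_shift_sub (BK _ Bx) (BK _ By) xyn).
  rewrite (ler_wpM2l (exprn_ge0 _ (ltW rho0)))//.
  by apply: KM; apply: iter_shift_stable; exact: BK.
Qed.

(* For x in K1 and y in K2, (x + c) - (a + c) = (x + y) - (a + y) is an identity
   between differences of points of K, so it holds digit by digit: the k-th
   digits available to K1 + c and to K2 + a have all their sums in a translate
   of the alphabet. *)
Lemma dimH_le_or_dimH_le (K1 K2 : set 'cV[R]_d) (beta s1 s2 : R) :
    K1 !=set0 -> K2 !=set0 -> set_add K1 K2 `<=` K ->
    rho `^ (- (2 * beta)) = (N ^ 2).-1%:R -> 2 * beta < s1 + s2 ->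
  (dimH K1 <= s1%:E)%E \/ (dimH K2 <= s2%:E)%E.
Proof.
move=> [a K1a] [c K2c] K12 hbeta hs.
have K12D x y : K1 x -> K2 y -> K (x + y).
  by move=> K1x K2y; apply: K12; exists x => //; exists y.
pose P1 k := [set i | `[< exists2 x, K1 x & itinerary (x + c) k = i >]]%SET.
pose P2 k := [set i | `[< exists2 y, K2 y & itinerary (y + a) k = i >]]%SET.
have leP k : (#|P1 k| * #|P2 k| <= (N ^ 2).-1)%N.
  apply: (card_mul_translate_lt (e := e) (a := e (itinerary (a + c) k))) => //.
    move=> v /eqP; rewrite -scaler_nat scaler_eq0 pnatr_eq0.
    by rewrite -leqn0 leqNgt N0 /= => /eqP.
  move=> i j; rewrite !inE => -[x K1x <-] [y K2y <-].
  exists (itinerary (x + y) k).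
  have E : (x + c) - (a + c) = (x + y) - (y + a).
    by rewrite opprD addrACA subrr addr0 [y + a]addrC opprD addrACA subrr addr0.
  have := itinerary_sub k (K12D _ _ K1x K2c) (K12D _ _ K1a K2c)
    (K12D _ _ K1x K2y) _ E.
  rewrite [y + a]addrC => /(_ (K12D _ _ K1a K2y)) /eqP.
  rewrite subr_eq => /eqP ->.
  by rewrite addrAC subrK.
(* Half the excess, so that [(s1 - delta) + (s2 - delta) = 2 * beta]. *)
pose delta := (s1 + s2 - 2 * beta) / 2.
have delta0 : 0 < delta by rewrite divr_gt0// subr_gt0.
pose p1 n := (\prod_(k < n) #|P1 k|)%N.
pose p2 n := (\prod_(k < n) #|P2 k|)%N.
have lep n : (p1 n)%:R * (p2 n)%:R <= (rho `^ (- (2 * beta))) ^+ n :> R.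
  rewrite hbeta -natrM -natrX ler_nat /p1 /p2 -big_split/=.
  rewrite -[X in (_ <= _ ^ X)%N]card_ord -prod_nat_const.
  by apply: leq_prod => k _; exact: leP.
(* Either [p1] is small at arbitrarily large levels, or it is large from some level on; in the
   latter case the product bound [lep] makes [p2] small at all those levels. *)
have [often|] := pselect (forall n0, exists2 n, (n0 <= n)%N &
    (p1 n)%:R <= (rho `^ (- (s1 - delta))) ^+ n).
  left; apply: (dimH_le_of_digits (v := c) (P := P1) (c := s1 - delta)) => //.
  - by exists a.
  - by move=> x K1x; exact: K12D.
  - by move=> x k K1x; rewrite !inE; exists x.
  - by rewrite ltrBlDr ltrDl.
move=> /existsNP[n0 rare1].
right; apply: (dimH_le_of_digits (v := a) (P := P2) (c := s2 - delta)) => //.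
- by exists c.
- by move=> y K2y; rewrite addrC; exact: K12D.
- by move=> y k K2y; rewrite !inE; exists y.
- by rewrite ltrBlDr ltrDl.
move=> m; exists (maxn n0 m); first exact: leq_maxr.
set n := maxn n0 m.
have : ~ ((p1 n)%:R <= (rho `^ (- (s1 - delta))) ^+ n).
  by move=> le1; apply: rare1; exists n => //; exact: leq_maxl.
move=> /negP; rewrite -ltNge => lt1; rewrite leNgt; apply/negP => lt2.
have := lep n; apply/negP; rewrite -ltNge.
have -> : - (2 * beta) = - (s1 - delta) + - (s2 - delta).
  by rewrite /delta; lra.
rewrite powRD; last by rewrite (gt_eqF rho0) implybT.
by rewrite exprMn; apply: ltr_pM => //; rewrite exprn_ge0// powR_ge0.
Qed.

End SelfSimilarDifferences.

(** Thresholds slightly below [x] and [y] refute a finite sum above [b]. Allowing negative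
    thresholds also excludes infinite values: [-1] defeats one alternative and a finite bound the
    other. *)
Lemma adde_le_of_le_or_le {R : realType} (x y : \bar R) (b : R) :
    (0 <= x)%E -> (0 <= y)%E ->
    (forall s1 s2 : R, b < s1 + s2 -> (x <= s1%:E)%E \/ (y <= s2%:E)%E) ->
  (x + y <= b%:E)%E.
Proof.
have lt_b : b < - 1 + (b + 2) by lra.
have neg1 (r : R) : (0 <= r%:E)%E -> (r%:E <= (- 1)%:E)%E -> False.
  by rewrite !lee_fin => r0 /(le_trans r0); rewrite lerNr oppr0 ler10.
move: x y => [x||] [y||] //=.
- rewrite !lee_fin => x0 y0 h; rewrite leNgt; apply/negP => bxy.
  pose delta := (x + y - b) / 3.
  have delta0 : 0 < delta by rewrite divr_gt0// subr_gt0.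
  have [||] := h (x - delta) (y - delta).
  + by move=> {h neg1}; rewrite /delta; lra.
  + by rewrite lee_fin leNgt ltrBlDr ltrDl delta0.
  + by rewrite lee_fin leNgt ltrBlDr ltrDl delta0.
- by move=> x0 _ /(_ _ _ lt_b)[/(neg1 _ x0)|].
- by move=> _ y0; rewrite addrC in lt_b; move=> /(_ _ _ lt_b)[|/(neg1 _ y0)].
- by move=> _ _ /(_ _ _ lt_b)[].
Qed.

(** * Choice of the constant and failure of the sumset properties *)

Theorem theorem1p1 (R : realType) (d : nat) (hd : (1 <= d)%N)
  (rho : R) (hrho0 : 0 < rho) (hrho1 : rho < 1)
  (O : 'M[R]_d) (hO : orthogonal_mx O)
  (D : set 'cV[R]_d) (hDfin : finite_set D)
  (hD2 : (2 <= #|` fset_set D|)%N)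
  (K : set 'cV[R]_d) (hK : self_similar_set D (similarity_map rho O) K) :
  self_similar_set (set_sub D D) (similarity_map rho O) (set_sub K K) /\
  (strong_separation (set_sub D D) (similarity_map rho O) (set_sub K K) ->
    [/\ exists beta : R,
          (beta%:E < dimH K)%E /\
          forall K1 K2 : set 'cV[R]_d,
            K1 !=set0 -> K2 !=set0 -> set_add K1 K2 `<=` K ->
            (dimH K1 + dimH K2 <= (2 * beta)%:E)%E,
        ~ HSPl 2 K &
        ~ HSP K]).
Proof.
split=> [|ssc]; first exact: self_similar_set_sub hK.
set N := #|` fset_set D| in hD2.
pose e (i : 'I_N) : 'cV[R]_d := nth 0 (fset_set D) i.
have einj : injective e.
  by move=> i j /eqP; rewrite nth_uniq ?fset_uniq// => /eqP/val_inj.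
have De : D = range e.
  apply/seteqP; split=> [x Dx|_ [i _ <-]].
    have xD : x \in fset_set D by rewrite in_fset_set// inE.
    have ix : (index x (fset_set D) < N)%N by rewrite index_mem.
    by exists (Ordinal ix) => //; rewrite /e nth_index.
  have : e i \in fset_set D by rewrite mem_nth.
  by rewrite in_fset_set// inE.
rewrite De in hK ssc.
have [dig [T digT]] := exists_digit_and_shift hD2 hK.
have lnr : ln rho < 0 by rewrite ln_lt0// hrho0.
have powrE z : rho `^ (z / ln rho) = expR z.
  by rewrite /powR gt_eqF// divfK// lt_eqF.
have N0 : (0 < N)%N by exact: leq_trans hD2.
have N21 : (1 < (N ^ 2).-1)%N.
  by rewrite -ltnS prednK ?expn_gt0 ?N0// (@leq_trans (2 ^ 2))// leq_sqr.
(* Chosen so that [rho ^ (- 2 beta) = N ^ 2 - 1], the bound on the number of digit pairs. *)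
pose beta := - ln (N ^ 2).-1%:R / ln rho / 2.
have beta2 : rho `^ (- (2 * beta)) = (N ^ 2).-1%:R.
  have -> : - (2 * beta) = ln (N ^ 2).-1%:R / ln rho.
    by rewrite /beta mulrC divfK// mulNr opprK.
  by rewrite powrE lnK// posrE ltr0n ltnW.
have beta0 : 0 <= beta.
  rewrite /beta divr_ge0// mulNr -mulrN -invrN mulr_ge0 ?invr_ge0 ?oppr_ge0 ?ltW//.
  by rewrite ln_gt0// ltr1n.
have betaK : (beta%:E < dimH K)%E.
  (* The gap is [ln (N ^ 2 - 1) < 2 ln N], divided by [- 2 ln rho > 0]. *)
  apply: (@lt_le_trans _ _ (- ln N%:R / ln rho)%:E).
    rewrite lte_fin /beta ltr_pdivrMr// mulrAC ltr_ndivlMr// divfK ?lt_eqF//.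
    rewrite mulNr ltrN2 mulr_natr -lnXn ?ltr0n// -natrX.
    rewrite ltr_ln ?posrE ?ltr0n ?expn_gt0 ?N0 ?(ltnW N21)//.
    by rewrite ltr_nat prednK ?expn_gt0 ?N0.
  apply: (le_dimH_self_similar hrho0 hrho1 hO hD2 einj hK ssc digT).
  by rewrite powrE expRN lnK// posrE ltr0n.
have bound K1 K2 : K1 !=set0 -> K2 !=set0 -> set_add K1 K2 `<=` K ->
    (dimH K1 + dimH K2 <= (2 * beta)%:E)%E.
  move=> K10 K20 K12; apply: adde_le_of_le_or_le => [||s1 s2 hs].
  - exact: dimH_ge0.
  - exact: dimH_ge0.
  - exact: (dimH_le_or_dimH_le hrho0 hrho1 hO hD2 einj hK ssc digT K10 K20 K12 beta2).
have noHSP2 : ~ HSPl 2 K.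
  move=> [A [_ AK dA]].
  (* [HSPl] allows empty summands; these have dimension 0, which is at most [beta] and so below
     [dimH K]. *)
  have A0 i : A i !=set0.
    apply/set0P/eqP => Ai0; have := dA i; rewrite Ai0.
    have : (dimH (set0 : set 'cV[R]_d) <= 0)%E.
      apply: dimH_le_of_covers => // eps eps0.
      exists 0%N, 0, (fun=> set0); split => //; first exact: ltW.
      by rewrite mul0r ltW.
    move=> le0 E; move: betaK; rewrite -E => /lt_le_trans/(_ le0).
    by rewrite lte_fin ltNge beta0.
  have := bound _ _ (A0 ord0) (A0 ord_max).
  have sumA : set_add (A ord0) (A ord_max) `<=` K.
    move=> _ [x Ax [y Ay <-]]; apply: AK.
    exists (fun i : 'I_2 => if i == ord0 then x else y).
      move=> i /=; case: (i =P ord0) => [->//|/eqP i0].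
      by rewrite (_ : i = ord_max)//; apply/val_inj; case: i i0 => -[|[]].
    by rewrite big_ord_recl big_ord1.
  move=> /(_ sumA); rewrite !dA; apply/negP; rewrite -ltNge.
  by rewrite mulr_natl mulr2n EFinD lteD.
split=> //; first by exists beta.
by move=> /(_ 2%N isT).
Qed.
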